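(* Let $\mu=l_1+l_2$ be a symmetric DGLA structure on a graded vector space $E=\oplus_{i\in\mathbb Z}E_i$ and let $\pi\in E_0$. Let $S$ be the Euler map of $E$. Then: (1) $\pi+S$ is a Nijenhuis vector valued form (with curvature $\pi\in E_0$) with respect to $\mu$ and with square $2\pi+S$ if, and only if, $\pi$ is a Poisson element, i.e. $l_2(\pi,\pi)=0$. (2) Assuming (1) is satisfied, the deformed structure $l_1(\pi)+(l_2(\pi,\cdot)+l_1)+l_2$ is a curved symmetric DGLA structure on $E$ (with curvature element $l_1(\pi)$, linear map $l_2(\pi,\cdot)+l_1$ and bracket $l_2$).
   Context: Let $E=\oplus_{i\in\mathbb Z}E_i$ be a graded vector space over $\mathbb R$ or $\mathbb C$; $|X|$ is the degree of homogeneous $X$. A symmetric vector valued $k$-form ($k\ge0$) is a graded symmetric $k$-linear map $K:E^{k}\to E$ (exchanging adjacent arguments $X,Y$ gives the sign $(-1)^{|X||Y|}$); a $0$-form is an element of $E$. It has degree $\bar K$ if $|K(X_1,\dots,X_k)|=|X_1|+\dots+|X_k|+\bar K$. A symmetric vector valued form is a formal sum of $k$-forms, $k\ge0$. For a $k$-form $K$ and $l$-form $L$, $$\iota_KL(X_1,\dots,X_{k+l-1})=\sum_{\sigma\in Sh(k,l-1)}\epsilon(\sigma)L(K(X_{\sigma(1)},\dots,X_{\sigma(k)}),X_{\sigma(k+1)},\dots,X_{\sigma(k+l-1)}),$$ with $Sh(k,l-1)$ the $(k,l-1)$-unshuffles and $\epsilon(\sigma)$ the Koszul sign; $\iota_KL=0$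 if $l=0$, and $\iota_KL=L(K,\dots)$ if $k=0$. The Richardson–Nijenhuis bracket is $[K,L]_{_{RN}}=\iota_KL-(-1)^{\bar K\bar L}\iota_LK$, extended bilinearly. For $\mu$ of degree $1$, a symmetric vector valued form $\mathcal N$ of degree $0$ is Nijenhuis with respect to $\mu$ with square $\mathcal K$ if $\mathcal K$ has degree $0$, $[\mathcal N,[\mathcal N,\mu]_{_{RN}}]_{_{RN}}=[\mathcal K,\mu]_{_{RN}}$ and $[\mathcal N,\mathcal K]_{_{RN}}=0$; ''with curvature'' means that $\mathcal N$ has a $0$-form component. The deformed structure is $[\mathcal N,\mu]_{_{RN}}$. Euler map: $S(X)=-|X|X$ for homogeneous $X$. Symmetric graded Lie bracket: a graded symmetric bilinear map $l_2$ of degree $1$ with $l_2(l_2(X,Y),Z)+(-1)^{|Y||Z|}l_2(l_2(X,Z),Y)+(-1)^{|X|(|Y|+|Z|)}l_2(l_2(Y,Z),X)=0$. Symmetric DGLA structure $l_1+l_2$: such an $l_2$ and a linear map $l_1$ of degree $1$ with $l_1^2=0$ and $l_1(l_2(X,Y))+l_2(l_1X,Y)+(-1)^{|X|}l_2(X,l_1Y)=0$. Curved symmetric DGLA structure $C+\mathrm d+l_2$: $C\in E_1$, $\mathrm d:E\to E$ linear of degree $1$, $l_2$ a symmetric graded Lie bracket of degree $1$, with $\mathrm d(C)=0$, $l_2(C,X)+\mathrm d^2X=0$, and $\mathrm d\,l_2(X,Y)+l_2(\mathrm dX,Y)+(-1)^{|X|}l_2(X,\mathrm dY)=0$. *)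

(* Defs.v *)
From HB Require Import structures.
From mathcomp Require Import all_boot all_order all_fingroup all_algebra.
From mathcomp Require Import boolp classical_sets functions cardinality fsbigop.
From mathcomp Require Import reals complex.

Set Implicit Arguments.
Unset Strict Implicit.
Unset Printing Implicit Defensive.

Import Order.TTheory GRing.Theory Num.Theory.
Local Open Scope classical_set_scope.
Local Open Scope ring_scope.

Variant ground := RealNumbers | ComplexNumbers.

Definition scalars (R : realType) (g : ground) : numFieldType :=
  match g with RealNumbers => R | ComplexNumbers => R[i] end.

(* Internal direct sums: each x is in a unique way a finitely supported sum of
   elements of the subspaces [homog i], and [comp i x] is its summand of
   degree i.  Big operators [\sum_(i \in A)] are sums over the support. *)
Record gvectType (F : fieldType) := GVect {
  gvect_sort :> lmodType F;
  homog : int -> set gvect_sort;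
  comp : int -> gvect_sort -> gvect_sort;
  homog0 : forall i, homog i 0;
  homogP : forall i a x y, homog i x -> homog i y -> homog i (a *: x + y);
  comp_homog : forall i x, homog i (comp i x);
  comp_finite : forall x, finite_set [set i | comp i x != 0];
  comp_sum : forall x, x = \sum_(i \in [set: int]) comp i x;
  comp_uniq : forall x (y : int -> gvect_sort),
    (forall i, homog i (y i)) -> finite_set [set i | y i != 0] ->
    x = \sum_(i \in [set: int]) y i -> forall i, y i = comp i x
}.

(* Since [seq E] is the disjoint union of the E^k, a formal sum of k-linear
   maps E^k -> E, k >= 0, is one function on [seq E]: its restriction to
   sequences of size k is the k-form component, and its value at [::] is the
   0-form component. *)
Definition form (F : fieldType) (E : gvectType F) := seq E -> E.

(* In [form_symm], only the two exchanged arguments have to be homogeneous: the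
   others are unconstrained by multilinearity. *)
Record symmetric_form (F : fieldType) (E : gvectType F) (p : int) (K : form E) :
    Prop := SymmetricForm {
  form_linear : forall (s t : seq E) (a : F) (x y : E),
    K (s ++ a *: x + y :: t) = a *: K (s ++ x :: t) + K (s ++ y :: t);
  form_symm : forall (s t : seq E) (i j : int) (x y : E),
    homog i x -> homog j y ->
    K (s ++ x :: y :: t) = (-1) ^ (i * j) *: K (s ++ y :: x :: t);
  form_degree : forall u : seq (int * E),
    (forall ix, ix \in u -> homog ix.1 ix.2) ->
    homog (\sum_(ix <- u) ix.1 + p) (K [seq ix.2 | ix <- u])
}.

Definition form0 (F : fieldType) (E : gvectType F) (c : E) : form E :=
  fun X => if X is [::] then c else 0.

Definition form1 (F : fieldType) (E : gvectType F) (f : E -> E) : form E :=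
  fun X => if X is [:: x] then f x else 0.

Definition form2 (F : fieldType) (E : gvectType F) (f : E -> E -> E) : form E :=
  fun X => if X is [:: x; y] then f x y else 0.

Definition unshuffle (n k : nat) (s : 'S_n) : bool :=
  [forall i : 'I_n, forall j : 'I_n,
    ((i < j) && ((j < k) || (k <= i)) ==> (s i < s j))%N].

Definition koszul_sign (F : fieldType) (n : nat) (d : 'I_n -> int) (s : 'S_n) :
    F :=
  \prod_(i < n) \prod_(j < n | (i < j)%N && (s j < s i)%N)
    (-1) ^ (d (s i) * d (s j)).

(* The insertion of K into L at homogeneous arguments Y_i of degrees d_i.  The
   k-th summand inserts the k-form component of K into the l-form component of
   L with k + (l - 1) = n, so that l >= 1. *)
Definition insertion_homog (F : fieldType) (E : gvectType F) (K L : form E)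
    (n : nat) (d : 'I_n -> int) (Y : 'I_n -> E) : E :=
  \sum_(k < n.+1) \sum_(s : 'S_n | unshuffle k s)
    koszul_sign F d s *:
      L (K [seq Y (s i) | i : 'I_n <- enum 'I_n & (i < k)%N]
           :: [seq Y (s i) | i : 'I_n <- enum 'I_n & (k <= i)%N]).

(* Multilinear extension of the preceding formula to all arguments: each
   argument is split into its homogeneous components, and the sum ranges over
   all multidegrees (finitely many contribute when K and L are multilinear). *)
Definition insertion (F : fieldType) (E : gvectType F) (K L : form E) : form E :=
  fun X => \sum_(d \in [set: {ffun 'I_(size X) -> int}])
    insertion_homog K L d (fun i => comp (d i) X`_i).

(* The sign depends on the degrees, hence p and q are explicit: they are the
   degrees of K and L. *)
Definition rn_bracket (F : fieldType) (E : gvectType F) (p q : int)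
    (K L : form E) : form E :=
  fun X => insertion K L X - (-1) ^ (p * q) *: insertion L K X.

Definition deformed (F : fieldType) (E : gvectType F) (N mu : form E) : form E :=
  rn_bracket 0 1 N mu.

Record nijenhuis (F : fieldType) (E : gvectType F) (mu N K : form E) : Prop :=
    Nijenhuis {
  nijenhuis_mu : symmetric_form 1 mu;
  nijenhuis_form : symmetric_form 0 N;
  nijenhuis_square : symmetric_form 0 K;
  nijenhuis_eq : rn_bracket 0 1 N (deformed N mu) =1 rn_bracket 0 1 K mu;
  nijenhuis_comm : rn_bracket 0 0 N K =1 (fun=> 0)
}.

Definition nijenhuis_with_curvature (F : fieldType) (E : gvectType F)
    (mu N K : form E) (c : E) : Prop :=
  nijenhuis mu N K /\ N [::] = c.

Definition euler (F : fieldType) (E : gvectType F) (x : E) : E :=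
  \sum_(i \in [set: int]) (- i%:~R) *: comp i x.

Definition linear_degree1 (F : fieldType) (E : gvectType F) (f : E -> E) : Prop :=
  (forall (a : F) x y, f (a *: x + y) = a *: f x + f y) /\
  (forall i x, homog i x -> homog (i + 1) (f x)).

Record symmetric_lie_bracket (F : fieldType) (E : gvectType F) (l2 : E -> E -> E) :
    Prop := SymmetricLieBracket {
  lie_linearl : forall (a : F) x y z, l2 (a *: x + y) z = a *: l2 x z + l2 y z;
  lie_linearr : forall (a : F) x y z, l2 z (a *: x + y) = a *: l2 z x + l2 z y;
  lie_degree : forall i j x y,
    homog i x -> homog j y -> homog (i + j + 1) (l2 x y);
  lie_symm : forall i j x y,
    homog i x -> homog j y -> l2 x y = (-1) ^ (i * j) *: l2 y x;
  lie_jacobi : forall i j k x y z, homog i x -> homog j y -> homog k z ->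
    l2 (l2 x y) z + (-1) ^ (j * k) *: l2 (l2 x z) y
      + (-1) ^ (i * (j + k)) *: l2 (l2 y z) x = 0
}.

Definition symmetric_leibniz (F : fieldType) (E : gvectType F)
    (l1 : E -> E) (l2 : E -> E -> E) : Prop :=
  forall i j x y, homog i x -> homog j y ->
    l1 (l2 x y) + l2 (l1 x) y + (-1) ^ i *: l2 x (l1 y) = 0.

Record symmetric_dgla (F : fieldType) (E : gvectType F)
    (l1 : E -> E) (l2 : E -> E -> E) : Prop := SymmetricDGLA {
  dgla_linear : linear_degree1 l1;
  dgla_bracket : symmetric_lie_bracket l2;
  dgla_square0 : forall x, l1 (l1 x) = 0;
  dgla_leibniz : symmetric_leibniz l1 l2
}.

Record curved_symmetric_dgla (F : fieldType) (E : gvectType F)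
    (C : E) (d : E -> E) (l2 : E -> E -> E) : Prop := CurvedSymmetricDGLA {
  curved_curvature : homog 1 C;
  curved_linear : linear_degree1 d;
  curved_bracket : symmetric_lie_bracket l2;
  curved_closed : d C = 0;
  curved_square : forall x, l2 C x + d (d x) = 0;
  curved_leibniz : symmetric_leibniz d l2
}.

Definition poisson_element (F : fieldType) (E : gvectType F)
    (l2 : E -> E -> E) (pi : E) : Prop :=
  homog 0 pi /\ l2 pi pi = 0.

(* Main.v *)
From mathcomp Require Import all_boot all_order all_fingroup all_algebra finmap.
From mathcomp Require Import boolp classical_sets cardinality fsbigop reals.
Require Import Defs.

Import GRing.Theory Num.Theory.
Local Open Scope ring_scope.

(** The Euler map S counts degrees: [S(Y) = - |Y| Y] on homogeneous Y. If Q is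
    a symmetric form of degree q, then inserting S into each argument of Q in
    turn multiplies Q(Y_1, ..., Y_n) by - (|Y_1| + ... + |Y_n|), while applying
    S to the value of Q multiplies it by - (|Y_1| + ... + |Y_n| + q). The
    difference is q Q, and inserting a 0-form p of degree 0 just fills one
    argument of Q, hence
      [p + S, Q](X) = Q(p, X) + q Q(X)          (lemma [rn_bracket_euler]).
    It is proved here for forms with components of arity at most two, which is
    all that mu, its deformation and the square involve.

    Everything else is read off from this formula. With N = pi + S and
    mu = l1 + l2,
      [N, mu] = l1(pi) + (l2(pi, .) + l1) + l2,
      [N, [N, mu]] - [2 pi + S, mu] = mu(pi, pi, .) = l2(pi, pi),
      [N, 2 pi + S] = S(pi) = 0,
    so the Nijenhuis equations reduce to l2(pi, pi) = 0. Once l2(pi, pi)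
    vanishes, the Leibniz rule and the Jacobi identity with one or two
    arguments equal to pi are the axioms of a curved structure for the twisted
    differential d = l2(pi, .) + l1; characteristic zero is used to divide
    2 l2(pi, l1(pi)) = 0 and 2 l2(pi, l2(pi, x)) = 0 by two.

    To evaluate an insertion at arbitrary arguments, it is computed at each
    tuple of homogeneous components and recognized as the value there of an
    explicit multilinear form M; the sum over all multidegrees is then M at the
    original arguments (lemma [multilinear_expansion]). *)

(** * Homogeneous components and multilinear expansion *)

Section Grading.
Set Implicit Arguments.
Unset Strict Implicit.
Variables (F : fieldType) (E : gvectType F).
Implicit Types (x y : E) (X : seq E).

Lemma linear_at0 (f : E -> E) :
  (forall a x y, f (a *: x + y) = a *: f x + f y) -> f 0 = 0.
Proof. by move=> linf; have := linf (-1) 0 0; rewrite scaler0 addr0 scaleN1r addNr. Qed.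

Lemma linear_scale (f : E -> E) a x :
  (forall a x y, f (a *: x + y) = a *: f x + f y) -> f (a *: x) = a *: f x.
Proof. by move=> linf; rewrite -[a *: x]addr0 linf linear_at0 ?addr0. Qed.

Lemma linear_add (f : E -> E) x y :
  (forall a x y, f (a *: x + y) = a *: f x + f y) -> f (x + y) = f x + f y.
Proof. by move=> linf; have := linf 1 x y; rewrite !scale1r. Qed.

Lemma fsum_seq (I : choiceType) (r : seq I) (f : I -> E) :
  uniq r -> (forall i, f i != 0 -> i \in r) ->
  \sum_(i \in [set: I]%classic) f i = \sum_(i <- r) f i.
Proof.
move=> r_uniq fr; rewrite (@fsbigE _ _ _ _ _ r) //; last first.
  by move=> i _; apply: contraNeq; exact: fr.
by apply: eq_bigl => i; rewrite in_setT.
Qed.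

Definition degrees x : seq int := fset_set [set i | comp i x != 0]%classic.

Lemma degrees_uniq x : uniq (degrees x).
Proof. exact: fset_uniq. Qed.

Lemma mem_degrees i x : (i \in degrees x) = (comp i x != 0).
Proof.
rewrite in_fset_set; last exact: comp_finite.
by apply/idP/idP; rewrite inE.
Qed.

Lemma comp_sum_seq (r : seq int) x :
  uniq r -> {subset degrees x <= r} -> x = \sum_(i <- r) comp i x.
Proof.
move=> r_uniq xr; rewrite {1}(comp_sum x) (fsum_seq r_uniq) // => i.
by rewrite -mem_degrees; exact: xr.
Qed.

Lemma comp_uniq_seq (r : seq int) x (y : int -> E) : uniq r ->
  (forall i, homog i (y i)) -> (forall i, y i != 0 -> i \in r) ->
  x = \sum_(i <- r) y i -> forall i, comp i x = y i.
Proof.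
move=> r_uniq hy yr xE i; apply/esym/comp_uniq => //; last by rewrite (fsum_seq r_uniq).
by apply: sub_finite_set (finite_seq r) => j /yr.
Qed.

(** The components of [x] and [y] combine to a decomposition of [a *: x + y], and
    decompositions are unique. *)
Lemma comp_linear i a x y : comp i (a *: x + y) = a *: comp i x + comp i y.
Proof.
pose r := undup (degrees x ++ degrees y).
have mem_r j : (j \in r) = (comp j x != 0) || (comp j y != 0).
  by rewrite mem_undup mem_cat !mem_degrees.
apply: (@comp_uniq_seq r _ (fun j => a *: comp j x + comp j y)).
- exact: undup_uniq.
- by move=> j; apply: homogP; exact: comp_homog.
- move=> j; rewrite mem_r; apply: contraNT; rewrite negb_or !negbK.
  by move=> /andP[/eqP-> /eqP->]; rewrite scaler0 addr0.
- rewrite big_split -scaler_sumr -!comp_sum_seq ?undup_uniq// => j;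
  by rewrite mem_r mem_degrees => ->; rewrite ?orbT.
Qed.

Lemma comp_homogE i j x : homog j x -> comp i x = if i == j then x else 0.
Proof.
move=> hx; apply: (@comp_uniq_seq [:: j] x (fun i => if i == j then x else 0)) => //.
- by move=> k; case: eqP => [->|_] //; exact: homog0.
- by move=> k; rewrite inE; case: (k =P j) => // _; rewrite eqxx.
- by rewrite big_seq1 eqxx.
Qed.

Lemma euler_seq (r : seq int) x : uniq r -> {subset degrees x <= r} ->
  euler x = \sum_(i <- r) (- i%:~R) *: comp i x.
Proof.
move=> r_uniq xr; apply: fsum_seq => // i; rewrite scaler_eq0 negb_or => /andP[_].
by rewrite -mem_degrees; exact: xr.
Qed.

Lemma euler_linear a x y : euler (a *: x + y) = a *: euler x + euler y.
Proof.
pose r := undup (degrees x ++ degrees y).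
have mem_r j : (j \in r) = (comp j x != 0) || (comp j y != 0).
  by rewrite mem_undup mem_cat !mem_degrees.
rewrite !(@euler_seq r) ?undup_uniq//; first last.
- move=> j; rewrite mem_r mem_degrees comp_linear; apply: contraNT.
  by rewrite negb_or !negbK => /andP[/eqP-> /eqP->]; rewrite scaler0 addr0.
- by move=> j; rewrite mem_r mem_degrees => ->.
- by move=> j; rewrite mem_r mem_degrees => ->; rewrite orbT.
rewrite scaler_sumr -big_split; apply: eq_bigr => i _ /=.
by rewrite comp_linear scalerDr !scalerA mulrC.
Qed.

Lemma euler_homog i x : homog i x -> euler x = (- i%:~R) *: x.
Proof.
move=> hx; rewrite (@euler_seq [:: i]) //.
  by rewrite big_seq1 (comp_homogE _ hx) eqxx.
move=> j; rewrite mem_degrees (comp_homogE _ hx) inE.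
by case: (j =P i) => // _; rewrite eqxx.
Qed.

Lemma homogZ i a x : homog i x -> homog i (a *: x).
Proof. by move=> hx; rewrite -[_ *: _]addr0; apply: homogP => //; exact: homog0. Qed.

Lemma homogD i x y : homog i x -> homog i y -> homog i (x + y).
Proof. by move=> hx hy; rewrite -[x]scale1r; apply: homogP. Qed.

Definition multilinear (M : form E) := forall (s t : seq E) (a : F) (x y : E),
  M (s ++ a *: x + y :: t) = a *: M (s ++ x :: t) + M (s ++ y :: t).

Lemma multilinear0 (M : form E) s t : multilinear M -> M (s ++ 0 :: t) = 0.
Proof.
by move=> hM; apply: (@linear_at0 (fun x => M (s ++ x :: t))) => a x y; exact: hM.
Qed.

Lemma multilinear_mem0 (M : form E) X : multilinear M -> 0 \in X -> M X = 0.
Proof. by move=> hM /splitPr[s t]; exact: multilinear0. Qed.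

Lemma multilinear_sum (M : form E) s t (I : Type) (r : seq I) (f : I -> E) :
  multilinear M ->
  M (s ++ \sum_(i <- r) f i :: t) = \sum_(i <- r) M (s ++ f i :: t).
Proof.
move=> hM; elim: r => [|i r IHr]; first by rewrite !big_nil multilinear0.
rewrite !big_cons -IHr.
by apply: (@linear_add (fun x => M (s ++ x :: t))) => a x y; exact: hM.
Qed.

(** A finite duplicate-free list of the multidegrees at which every component of
    the arguments is nonzero; outside it all multilinear forms vanish, so that
    sums over all multidegrees become sums over this list. *)
Fixpoint multidegrees X : seq (seq int) :=
  if X is x :: X' then [seq i :: l | i <- degrees x, l <- multidegrees X']
  else [:: [::]].

Definition comps (l : seq int) X : seq E := [seq comp ix.1 ix.2 | ix <- zip l X].

Lemma multidegrees_uniq X : uniq (multidegrees X).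
Proof.
elim: X => //= x X IHX; apply: allpairs_uniq; rewrite ?degrees_uniq//.
by move=> [i l] [j m] _ _ /= [-> ->].
Qed.

Lemma mem_multidegrees l X :
  (l \in multidegrees X) = (size l == size X) && (0 \notin comps l X).
Proof.
elim: X l => [|x X IHX] [|i l] //=.
  by apply/allpairsP => -[[j m] /= []].
rewrite eqSS inE negb_or [0 == _]eq_sym andbCA -IHX -mem_degrees.
apply/allpairsP/andP => [[[j m] /= [hj hm [-> ->]]] // | [hi hl]].
by exists (i, l).
Qed.

Lemma multilinear_comps (M : form E) s X : multilinear M ->
  M (s ++ X) = \sum_(l <- multidegrees X) M (s ++ comps l X).
Proof.
move=> hM; elim: X s => [|x X IHX] s; first by rewrite big_seq1.
rewrite /= {1}(@comp_sum_seq (degrees x) x) ?degrees_uniq// multilinear_sum//.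
rewrite big_allpairs_dep; apply: eq_bigr => i _ /=.
by rewrite -cat_rcons IHX; apply: eq_bigr => l _; rewrite -cat_rcons.
Qed.

Definition homog_part X (d : {ffun 'I_(size X) -> int}) : seq E :=
  [seq comp (d i) X`_i | i : 'I_(size X) <- enum 'I_(size X)].

Lemma homog_partE X d : homog_part d = comps [seq d i | i <- enum 'I_(size X)] X.
Proof.
have size_d : size [seq d i | i <- enum 'I_(size X)] = size X.
  by rewrite size_map size_enum_ord.
apply: (@eq_from_nth _ 0) => [|i]; rewrite size_map size_enum_ord.
  by rewrite size_map size_zip size_d minnn.
move=> ltiX; rewrite (nth_map (Ordinal ltiX)) ?size_enum_ord//.
rewrite (nth_map (0, 0)) ?size_zip ?size_d ?minnn// nth_zip//=.
rewrite (nth_map (Ordinal ltiX)) ?size_enum_ord//.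
by rewrite (nth_ord_enum _ (Ordinal ltiX)).
Qed.

(** The left-hand side has the shape of the definition of [insertion]: an
    insertion that agrees with a multilinear [M] at homogeneous components is
    thereby equal to [M]. Multidegrees are finite functions on the left and lists
    in [multidegrees X]; [mdeg] translates between them. *)
Lemma multilinear_expansion (M : form E) X : multilinear M ->
  \sum_(d \in [set: {ffun 'I_(size X) -> int}]%classic) M (homog_part d) = M X.
Proof.
move=> hM.
pose mdeg l : {ffun 'I_(size X) -> int} := [ffun i : 'I_(size X) => l`_i].
have mdegK l : l \in multidegrees X -> [seq mdeg l i | i <- enum 'I_(size X)] = l.
  rewrite mem_multidegrees => /andP[/eqP size_l _].
  apply: (@eq_from_nth _ 0); rewrite size_map size_enum_ord// => i ltiX.
  rewrite (nth_map (Ordinal ltiX)) ?size_enum_ord// ffunE.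
  by rewrite (nth_ord_enum _ (Ordinal ltiX)).
rewrite (@fsum_seq _ [seq mdeg l | l <- multidegrees X]).
- rewrite big_map -[in RHS](cat0s X) multilinear_comps// !big_seq.
  by apply: eq_bigr => l lX; rewrite homog_partE mdegK.
- rewrite map_inj_in_uniq ?multidegrees_uniq// => l m lX mX lm.
  by rewrite -(mdegK l lX) lm mdegK.
- move=> d nz; apply/mapP; exists [seq d i | i <- enum 'I_(size X)].
    rewrite mem_multidegrees size_map size_enum_ord eqxx -homog_partE.
    by apply: contra nz => /(multilinear_mem0 hM) ->.
  apply/ffunP => i; rewrite ffunE (nth_map i) ?size_enum_ord//.
  by rewrite nth_ord_enum.
Qed.

End Grading.

(** * Insertions at homogeneous arguments *)

Section Insertion.
Set Implicit Arguments.
Unset Strict Implicit.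
Variables (F : fieldType) (E : gvectType F).
Implicit Types (x y : E) (X : seq E).

(** The values of an increasing permutation form a sorted list with the same
    members as the sorted list of all indices. *)
Lemma increasing_perm n (s : 'S_n) :
  (forall i j : 'I_n, (i < j)%N -> (s i < s j)%N) -> s = 1%g.
Proof.
move=> s_incr; apply/permP => i; rewrite perm1; apply: val_inj.
have sE : [seq val (s j) | j <- enum 'I_n] = [seq val j | j <- enum 'I_n].
  apply: (irr_sorted_eq ltn_trans ltnn).
  - rewrite sorted_map; apply: (sub_sorted (e := relpre val ltn)).
      by move=> j k /s_incr.
    by rewrite -sorted_map val_enum_ord iota_ltn_sorted.
  - by rewrite val_enum_ord iota_ltn_sorted.
  - move=> m; apply/mapP/mapP => [] [j _ ->]; first by exists (s j); rewrite ?mem_enum.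
    by exists ((s^-1)%g j); rewrite ?mem_enum ?permKV.
by move/eq_in_map: sE => /(_ i) -> //; rewrite mem_enum.
Qed.

(** When one of the two blocks of an unshuffle is empty, the permutation is
    increasing everywhere. *)
Lemma unshuffle_extremal n k (s : 'S_n) :
  (k == 0)%N || (k == n) -> unshuffle k s = (s == 1%g).
Proof.
move=> k_extremal; apply/forallP/eqP => [s_unsh | -> i]; last first.
  by apply/forallP => j; apply/implyP => /andP[]; rewrite !perm1.
apply: increasing_perm => i j ltij; have /forallP/(_ j) := s_unsh i.
rewrite ltij /=; case/orP: k_extremal => /eqP->; first by rewrite leq0n orbT.
by rewrite ltn_ord.
Qed.

Lemma koszul_sign1 n (d : 'I_n -> int) : koszul_sign F d 1%g = 1.
Proof.
rewrite /koszul_sign big1 // => i _; rewrite big1 // => j /andP[].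
by rewrite !perm1 => /ltnW; rewrite leqNgt => /negPf->.
Qed.

Lemma sum_perm2 (V : nmodType) (f : 'S_2 -> V) :
  \sum_(s : 'S_2) f s = f 1%g + f (tperm ord0 ord_max).
Proof.
have neq1 : 1%g != tperm ord0 ord_max :> 'S_2.
  by apply/eqP => /permP/(_ ord0); rewrite tpermL perm1.
have S2 : [set: 'S_2] = [set 1%g; tperm ord0 ord_max].
  by apply/esym/eqP; rewrite eqEcard finset.subsetT cardsT card_Sn cards2 neq1.
transitivity (\sum_(s in [set 1%g; tperm ord0 ord_max]) f s).
  by rewrite -S2; apply: eq_bigl => s; rewrite finset.in_setT.
by rewrite big_setU1 ?finset.in_set1//= big_set1.
Qed.

(** As [L] takes at most one argument, [K] has to absorb all the arguments, and
    the only unshuffle left is the identity. *)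
Lemma insertion_homog_into_affine (K L : form E) n (d : 'I_n -> int) (Y : 'I_n -> E) :
  (forall x y t, L [:: x, y & t] = 0) ->
  insertion_homog K L d Y = L [:: K [seq Y i | i <- enum 'I_n]].
Proof.
move=> L_affine; rewrite /insertion_homog big_ord_recr /= big1 => [|k _].
  rewrite add0r (eq_bigl (pred1 1%g)) => [|s]; last by rewrite unshuffle_extremal ?eqxx ?orbT.
  rewrite big_pred1_eq koszul_sign1 scale1r.
  rewrite (@eq_filter _ (fun i : 'I_n => i < n)%N predT) => [|i]; last by rewrite ltn_ord.
  rewrite (@eq_filter _ (fun i : 'I_n => n <= i)%N pred0) => [|i]; last by rewrite leqNgt ltn_ord.
  rewrite filter_predT filter_pred0; congr (L [:: K _]).
  by apply: eq_map => i; rewrite perm1.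
apply: big1 => s _; case lE: [seq i : 'I_n <- enum 'I_n | (k <= i)%N] => [|i l]; last by rewrite L_affine scaler0.
suff : k \in [::] by [].
by rewrite -lE mem_filter leqnn mem_enum.
Qed.

Lemma koszul_sign_tperm (d : 'I_2 -> int) :
  koszul_sign F d (tperm ord0 ord_max) = (-1) ^ (d ord0 * d ord_max).
Proof.
have -> : ord_max = lift ord0 ord0 :> 'I_2 by apply: val_inj.
rewrite /koszul_sign; under eq_bigr do rewrite big_mkcond.
by rewrite !(big_ord_recl, big_ord0) /= tpermL tpermR !(mulr1, mul1r) [d ord0 * _]mulrC.
Qed.

(** The 0-form [p] is inserted in front. The Euler map is inserted at each
    argument in turn: the Koszul sign of the unshuffle that moves this argument
    to the front is undone by the graded symmetry of [Q], so each insertion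
    contributes minus the degree of the argument. *)
Lemma insertion_homog_euler (Q : form E) q p n (d : 'I_n -> int) (Y : 'I_n -> E) :
  symmetric_form q Q -> (forall x y z t, Q [:: x, y, z & t] = 0) ->
  (forall i, homog (d i) (Y i)) ->
  let X := [seq Y i | i <- enum 'I_n] in
  insertion_homog (form0 p \+ form1 (@euler _ E)) Q d Y
    = Q (p :: X) - (\sum_i d i)%:~R *: Q X.
Proof.
move=> symQ Q_quad hY /=; have linQ := form_linear symQ; rewrite /insertion_homog.
case: n d Y hY => [|[|[|n]]] d Y hY.
- rewrite big_ord1 (eq_bigl (pred1 1%g)) => [|s]; last by rewrite unshuffle_extremal.
  by rewrite big_pred1_eq koszul_sign1 enum_ord0 /= big_ord0 scale0r subr0 scale1r addr0.
- rewrite big_ord_recl big_ord1 /=.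
  rewrite (eq_bigl (pred1 1%g)) => [|s]; last by rewrite unshuffle_extremal.
  rewrite [X in _ + X](eq_bigl (pred1 1%g)) => [|s]; last by rewrite unshuffle_extremal.
  rewrite !big_pred1_eq koszul_sign1 !scale1r enum_ordSl enum_ord0 /= !perm1.
  rewrite addr0 add0r (euler_homog (hY _)) big_ord1.
  rewrite (@linear_scale _ _ (fun x => Q [:: x])) ?scaleNr// => a x y.
  exact: (linQ [::] [::]).
- rewrite !big_ord_recl big_ord0 /= addr0.
  rewrite (eq_bigl (pred1 1%g)) => [|s]; last by rewrite unshuffle_extremal.
  rewrite [X in _ + (_ + X)](eq_bigl (pred1 1%g)) => [|s]; last by rewrite unshuffle_extremal.
  rewrite [X in _ + (X + _)](eq_bigl predT) => [|s]; last first.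
    apply/forallP => -[[|[|i]] ?] //; apply/forallP => -[[|[|j]] ?] //.
  rewrite !big_pred1_eq sum_perm2 !enum_ordSl !enum_ord0 /=.
  rewrite !koszul_sign1 !scale1r !perm1 !(addr0, add0r).
  have -> : lift ord0 ord0 = ord_max :> 'I_2 by apply: val_inj.
  rewrite Q_quad add0r (multilinear0 [::] [::] linQ) addr0 tpermL tpermR.
  rewrite koszul_sign_tperm !(euler_homog (hY _)) big_ord0 addr0.
  have scaleQ a x y : Q [:: a *: x; y] = a *: Q [:: x; y].
    by apply: (@linear_scale _ _ (fun x => Q [:: x; y])) => b u v; exact: (linQ [::]).
  rewrite !scaleQ scalerA mulrC -scalerA.
  (* moving the second argument back behind the first absorbs the Koszul sign *)
  rewrite -(form_symm symQ [::] [::] (hY ord0) (hY ord_max)) /=.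
  by rewrite !scaleNr -opprD -scalerDl rmorphD sub0r.
- have Q0 : Q [seq Y i | i <- enum 'I_n.+3] = 0 by rewrite !enum_ordSl /= Q_quad.
  rewrite Q0 scaler0 subr0 [in RHS]enum_ordSl [in RHS]enum_ordSl /= Q_quad.
  apply: big1 => k _; apply: big1 => s _.
  (* three arguments are split between both forms, so that one of them receives
     two: too many for the inner form, or, with the inserted value, for Q *)
  have := count_predC (fun i : 'I_n.+3 => (i < k)%N) (enum 'I_n.+3).
  rewrite size_enum_ord -!size_filter.
  rewrite (@eq_filter _ (predC _) (fun i : 'I_n.+3 => (k <= i)%N)) => [|i]; last first.
    by rewrite /= -leqNgt.
  case: [seq i : 'I_n.+3 <- _ | (k <= i)%N] => [|i [|j l]]; last by rewrite Q_quad scaler0.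
    all: case: [seq i : 'I_n.+3 <- _ | (i < k)%N] => [|i' [|j' l']] //= _.
    all: by rewrite addr0 (multilinear0 [::] _ linQ) scaler0.
Qed.
End Insertion.

(** * The bracket with the Euler map *)

Section Euler.
Set Implicit Arguments.
Unset Strict Implicit.
Variables (F : fieldType) (E : gvectType F).
Implicit Types (x y : E) (X : seq E).

Lemma euler_form (Q : form E) q n (d : 'I_n -> int) (Y : 'I_n -> E) :
  symmetric_form q Q -> (forall i, homog (d i) (Y i)) ->
  let X := [seq Y i | i <- enum 'I_n] in
  euler (Q X) = - (\sum_i d i)%:~R *: Q X - q%:~R *: Q X.
Proof.
move=> symQ hY X; pose u := [seq (d i, Y i) | i <- enum 'I_n].
have hu ix : ix \in u -> homog ix.1 ix.2 by case/mapP => i _ -> /=.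
have := form_degree symQ hu; rewrite -map_comp big_map big_enum /=. move=> /euler_homog ->.
by rewrite rmorphD opprD scalerDl !scaleNr.
Qed.

(** At arguments of total degree e, [insertion_homog_euler] gives
    [Q (p :: X) - e Q X], and the Euler map multiplies [Q X] by [- (e + q)].
    Trading e for the Euler map leaves an expression that does not mention
    degrees of arguments and is multilinear. *)
Lemma insertion_euler_left (Q : form E) q p X :
  symmetric_form q Q -> (forall x y z t, Q [:: x, y, z & t] = 0) ->
  insertion (form0 p \+ form1 (@euler _ E)) Q X
    = Q (p :: X) + euler (Q X) + q%:~R *: Q X.
Proof.
move=> symQ Q_quad; have linQ := form_linear symQ.
pose M : form E := fun X => Q (p :: X) + euler (Q X) + q%:~R *: Q X.
have linM : multilinear M.
  move=> s t a x y; rewrite /M (linQ (p :: s)) linQ euler_linear !scalerDr !scalerA.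
  by rewrite [q%:~R * a]mulrC; rewrite [LHS](AC (2*2*2) ((1*3*5)*(2*4*6))).
rewrite -[RHS](multilinear_expansion X linM); apply: eq_fsbigr => d _.
have hY (i : 'I_(size X)) : homog (d i) (comp (d i) X`_i) by exact: comp_homog.
by rewrite (insertion_homog_euler _ symQ Q_quad hY) /M (euler_form symQ hY) scaleNr addrA addrNK.
Qed.

Lemma insertion_euler_right (Q : form E) p X : multilinear Q ->
  insertion Q (form0 p \+ form1 (@euler _ E)) X = euler (Q X).
Proof.
move=> linQ; have linM : multilinear (fun X => euler (Q X)).
  by move=> s t a x y; rewrite linQ euler_linear.
rewrite -[RHS](multilinear_expansion X linM); apply: eq_fsbigr => d _.
by rewrite insertion_homog_into_affine /= ?add0r// => *; rewrite addr0.
Qed.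

(** Up to the insertion of [p], bracketing with the Euler map multiplies a form
    by its degree. *)
Lemma rn_bracket_euler (Q : form E) q p X :
  symmetric_form q Q -> (forall x y z t, Q [:: x, y, z & t] = 0) ->
  rn_bracket 0 q (form0 p \+ form1 (@euler _ E)) Q X = Q (p :: X) + q%:~R *: Q X.
Proof.
move=> symQ Q_quad; rewrite /rn_bracket mul0r expr0z scale1r.
rewrite (insertion_euler_left _ _ symQ)// insertion_euler_right; last exact: form_linear symQ.
by rewrite addrAC addrK.
Qed.

Lemma symmetric_form_form0 q (c : E) : homog q c -> symmetric_form q (form0 c).
Proof.
move=> hc; split => [[|z s] t a x y|[|z s] t i j x y _ _|[|ix u] _] /=;
  rewrite ?scaler0 ?addr0 ?big_nil ?add0r //; exact: homog0.
Qed.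

Lemma symmetric_form_form1 q (f : E -> E) :
  (forall a x y, f (a *: x + y) = a *: f x + f y) ->
  (forall i x, homog i x -> homog (i + q) (f x)) -> symmetric_form q (form1 f).
Proof.
move=> linf hf; split.
- by move=> [|z [|z' s]] [|z'' t] a x y; rewrite /= ?scaler0 ?addr0.
- by move=> [|z [|z' s]] t i j x y _ _; rewrite /= ?scaler0.
- move=> [|ix [|jy u]] hu; rewrite ?big_seq1 /=; try exact: homog0.
  by apply/hf/hu; rewrite mem_head.
Qed.

Lemma symmetric_form_form2 (l2 : E -> E -> E) :
  symmetric_lie_bracket l2 -> symmetric_form 1 (form2 l2).
Proof.
move=> Hl2; split.
- move=> [|z [|z' [|z'' s]]] [|u [|v t]] a x y; rewrite /= ?scaler0 ?addr0//.
    exact: lie_linearl.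
  exact: lie_linearr.
- move=> [|z [|z' [|z'' s]]] [|u t] i j x y hx hy; rewrite /= ?scaler0//.
  exact: lie_symm.
- move=> [|ix [|jy [|kz u]]] hu; try exact: homog0.
  rewrite big_cons big_seq1 /=.
  by apply: (lie_degree Hl2); apply: hu; rewrite !inE eqxx ?orbT.
Qed.

Lemma symmetric_formD q (K L : form E) :
  symmetric_form q K -> symmetric_form q L -> symmetric_form q (K \+ L).
Proof.
move=> symK symL; split.
- move=> s t a x y; rewrite /= (form_linear symK) (form_linear symL) scalerDr.
  by rewrite addrACA.
- by move=> s t i j x y hx hy; rewrite /= (form_symm symK s t hx hy)
    (form_symm symL s t hx hy) scalerDr.
- by move=> u hu; apply: homogD; [exact: form_degree|exact: form_degree].
Qed.

Lemma symmetric_form_euler (p : E) : homog 0 p ->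
  symmetric_form 0 (form0 p \+ form1 (@euler _ E)).
Proof.
move=> hp; apply: symmetric_formD; first exact: symmetric_form_form0.
apply: symmetric_form_form1; first exact: euler_linear.
by move=> i x hx; rewrite addr0 (euler_homog hx); exact: homogZ.
Qed.

Lemma linear_homog_eq0 (f : E -> E) :
  (forall a x y, f (a *: x + y) = a *: f x + f y) ->
  (forall i x, homog i x -> f x = 0) -> forall x, f x = 0.
Proof.
move=> linf f0 x.
have linM : multilinear (form1 f).
  by move=> [|z [|z' s]] [|z'' t] a y z0; rewrite /= ?scaler0 ?addr0.
have /= -> := multilinear_comps [::] [:: x] linM.
apply: big1 => -[|i [|j l]] _ //=; apply: f0; exact: comp_homog.
Qed.
End Euler.

(** * Poisson elements of a symmetric DGLA *)

Section Poisson.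
Set Implicit Arguments.
Unset Strict Implicit.
Variables (F : numFieldType) (E : gvectType F) (l1 : E -> E) (l2 : E -> E -> E).
Hypothesis hmu : symmetric_dgla l1 l2.
Variable p : E.
Hypothesis hp : homog 0 p.

Let l1_linear := (dgla_linear hmu).1.
Let l1_degree := (dgla_linear hmu).2.
Let l2_lie := dgla_bracket hmu.
Let l2_linearl := lie_linearl l2_lie.
Let l2_linearr := lie_linearr l2_lie.
Let mu : form E := form1 l1 \+ form2 l2.
Let N : form E := form0 p \+ form1 (@euler _ E).
Let K : form E := form0 (2 *: p) \+ form1 (@euler _ E).
Let d x := l2 p x + l1 x.
Let mu' : form E := (form0 (l1 p) \+ form1 d) \+ form2 l2.

Lemma double_eq0 (x : E) : x + x = 0 -> x = 0.
Proof.
by rewrite -mulr2n -scaler_nat => /eqP; rewrite scaler_eq0 pnatr_eq0 => /eqP.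
Qed.

Lemma l2p_homog i x : homog i x -> homog (i + 1) (l2 p x).
Proof. by move=> hx; have := lie_degree l2_lie hp hx; rewrite add0r. Qed.

Lemma l2_symmp i x : homog i x -> l2 x p = l2 p x.
Proof. by move=> hx; rewrite (lie_symm l2_lie hx hp) mulr0 expr0z scale1r. Qed.

Lemma l1p_homog : homog 1 (l1 p).
Proof. by have := l1_degree hp; rewrite add0r. Qed.

Lemma twisted_differential_linear : linear_degree1 d.
Proof.
split=> [a x y|i x hx]; last by apply: homogD; [exact: l2p_homog|exact: l1_degree].
by rewrite /d l2_linearr l1_linear scalerDr addrACA.
Qed.

Lemma mu_symmetric : symmetric_form 1 mu.
Proof.
apply: symmetric_formD; last exact: symmetric_form_form2.
exact: symmetric_form_form1.
Qed.

Lemma deformed_symmetric : symmetric_form 1 mu'.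
Proof.
have [d_linear d_degree] := twisted_differential_linear.
apply: symmetric_formD; last exact: symmetric_form_form2.
apply: symmetric_formD; first exact: symmetric_form_form0 l1p_homog.
exact: symmetric_form_form1.
Qed.

Lemma deformed_mu : deformed N mu =1 mu'.
Proof.
move=> X; rewrite /deformed (rn_bracket_euler _ _ mu_symmetric) => [|*]; last exact: addr0.
rewrite scale1r /mu' /mu /d.
by case: X => [|x [|y [|z t]]] /=; rewrite !(addr0, add0r).
Qed.

(** Both sides of the Nijenhuis equation are given by [rn_bracket_euler] and
    differ only in their 0-form components, by [l2 p p]. *)
Lemma nijenhuis_poisson : nijenhuis_with_curvature mu N K p <-> poisson_element l2 p.
Proof.
have l2Z a x y : l2 (a *: x) y = a *: l2 x y.
  by apply: (linear_scale (f := l2^~ y)) => b u v; exact: l2_linearl.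
have l1Z a x : l1 (a *: x) = a *: l1 x by exact: linear_scale.
have bracketK X : rn_bracket 0 1 K mu X = mu (2 *: p :: X) + mu X.
  by rewrite (rn_bracket_euler _ _ mu_symmetric) ?scale1r// => *; exact: addr0.
have bracketN X : rn_bracket 0 1 N (deformed N mu) X = mu' (p :: X) + mu' X.
  rewrite (_ : deformed N mu = mu'); last exact/funext/deformed_mu.
  by rewrite (rn_bracket_euler _ _ deformed_symmetric) ?scale1r// => *; rewrite /mu' /= !addr0.
split=> [[[_ _ _ sqN _] _]|[_ pp0]].
  split=> //; have := sqN [::]; rewrite bracketN bracketK /mu' /mu /d /=.
  rewrite !(addr0, add0r) l1Z scaler_nat mulr2n -addrA => /eqP.
  by rewrite -subr_eq0 addrK => /eqP.
split; last by rewrite /N /= addr0.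
split.
- exact: mu_symmetric.
- exact: symmetric_form_euler.
- by apply: symmetric_form_euler; exact: homogZ.
- move=> X; rewrite bracketN bracketK /mu' /mu /d.
  case: X => [|x [|y t]] /=; rewrite !(addr0, add0r) ?l1Z ?l2Z ?scaler_nat ?mulr2n.
  + by rewrite pp0 add0r.
  + by rewrite addrA.
  + by [].
- move=> X; rewrite (rn_bracket_euler (q := 0)) => [||*]; last by rewrite /K /= addr0.
    rewrite scale0r addr0 /K; case: X => [|x t] /=; rewrite ?addr0//.
    by rewrite (euler_homog hp) mulr0z oppr0 scale0r addr0.
  by apply: symmetric_form_euler; exact: homogZ.
Qed.

(** The closedness of the curvature is the Leibniz rule at (p, p). The square and
    the Leibniz rule of [d] split by the number of occurrences of [p]: the part
    without [p] is an identity of the given structure, the linear part of the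
    square is the Leibniz rule at (p, x) and its quadratic part the Jacobi
    identity at (p, p, x), and the linear part of the Leibniz rule is the Jacobi
    identity at (p, x, y). *)
Lemma twisted_dgla : l2 p p = 0 -> curved_symmetric_dgla (l1 p) d l2.
Proof.
move=> pp0; have l1l1 := dgla_square0 hmu; have leib := dgla_leibniz hmu.
have [d_linear d_degree] := twisted_differential_linear.
have l1D x y : l1 (x + y) = l1 x + l1 y by exact: linear_add.
have l2Dl x y z : l2 (x + y) z = l2 x z + l2 y z.
  by apply: (linear_add (f := l2^~ z)) => b u v; exact: l2_linearl.
have l2Dr x y z : l2 z (x + y) = l2 z x + l2 z y.
  by apply: linear_add => b u v; exact: l2_linearr.
have l20 z : l2 0 z = 0.
  by apply: (linear_at0 (f := l2^~ z)) => b u v; exact: l2_linearl.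
have l10 : l1 0 = 0 by exact: linear_at0.
have l2pp0 i x : homog i x -> l2 p (l2 p x) = 0.
  move=> hx; have := lie_jacobi l2_lie hp hp hx.
  rewrite pp0 l20 !mul0r !expr0z !scale1r add0r.
  by rewrite (l2_symmp (l2p_homog hx)) => /double_eq0.
split.
- exact: l1p_homog.
- by [].
- exact: l2_lie.
- rewrite /d l1l1 addr0; have := leib _ _ _ _ hp hp.
  rewrite pp0 l10 add0r expr0z scale1r (l2_symmp l1p_homog).
  exact: double_eq0.
- apply: linear_homog_eq0 => [a x y|i x hx].
    by rewrite !d_linear l2_linearr [a *: (l2 _ x + _)]scalerDr addrACA.
  rewrite /d l2Dr (l2pp0 _ _ hx) add0r l1D l1l1 addr0.
  have := leib _ _ _ _ hp hx; rewrite expr0z scale1r => <-.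
  by rewrite [RHS](ACl (2*(3*1))).
- move=> i j x y hx hy; rewrite /d l2Dl l2Dr scalerDr.
  (* terms with p first, where Jacobi at (p, x, y) applies; then the Leibniz rule
     for l1 *)
  rewrite [LHS](AC (2*2*2) ((3*5*1)*(2*4*6))).
  rewrite /= (leib _ _ _ _ hx hy) addr0.
  have sign2 : (-1) ^ i * (-1) ^ i = 1 :> F by rewrite -expfzMl mulrNN mul1r exp1rz.
  have := lie_jacobi l2_lie hp hx hy; rewrite mul0r expr0z scale1r.
  rewrite (l2_symmp (lie_degree l2_lie hx hy)) => <-; congr (_ + _ + _).
  rewrite (lie_symm l2_lie hx (l2p_homog hy)) scalerA mulrDr mulr1.
  by rewrite expfzDr ?oppr_eq0 ?oner_eq0// mulrCA sign2 mulr1.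
Qed.
End Poisson.

Theorem corollary2p4p10 (R : realType) (g : ground) (E : gvectType (scalars R g))
    (l1 : E -> E) (l2 : E -> E -> E) (hmu : symmetric_dgla l1 l2)
    (pi : E) (hpi : homog 0 pi) :
  let mu := form1 l1 \+ form2 l2 in
  let N := form0 pi \+ form1 (@euler _ E) in
  let K := form0 (2 *: pi) \+ form1 (@euler _ E) in
  (nijenhuis_with_curvature mu N K pi <-> poisson_element l2 pi) /\
  (nijenhuis_with_curvature mu N K pi ->
     deformed N mu
       =1 (form0 (l1 pi) \+ form1 (fun x => l2 pi x + l1 x)) \+ form2 l2 /\
     curved_symmetric_dgla (l1 pi) (fun x => l2 pi x + l1 x) l2).
Proof.
move=> mu N K; split; first exact: nijenhuis_poisson.
move=> nij; split; first exact: deformed_mu.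
by apply: (twisted_dgla hmu hpi); have [/(_ nij)[]] := nijenhuis_poisson hmu hpi.
Qed.
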